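(* Let $G$ be a group generated by a finite set $X$ and with the Word Problem in a complexity class $C_1(n)$. Suppose $G/N$ is a quotient of $G$ such that: (1) $G/N\in\mathcal{FB}_{exp}$; (2) the canonical epimorphism $\phi:G\to G/N$ is computable within time $C_2(n)$; (3) for every $k\in\mathbb N$ there exists an algorithm $\mathcal A_k$ in a complexity class $C_3(n)$ which solves the Membership Search Problem in $G/N$ for an exponentially generic set $M_k\subseteq F(X)^k$ of descriptions of $k$-generated subgroups in $G/N$. Then for every $k,m>0$ there exists an algorithm $\mathcal C_{k,m}$ that solves the SCSP* in $G$ on an exponentially generic subset of the set of all inputs $I_{k,m}$ for SCSP*. Furthermore, $\mathcal C_{k,m}$ belongs to the complexity class $n^2+C_1(n)+C_2(n)+C_3(n)$.
   Context: A finite generating set of a group is understood as a finite alphabet $X$ with a map to the group (not necessarily injective) whose image generates; $X$ is thus also a generating set of $G/N$ via $\phi$, and words in the free group $F(X)$ are evaluated in $G$ or in $G/N$. A description of a $k$-generated subgroup $H$ is a tuple $(u_1,\dots,u_k)\in F(X)^k$ whose evaluations generate $H$. Membership Search Problem for $H=\langle u_1,\dots,u_k\rangle$: given a word $w\in F(X)$ that represents an element of $H$, find a representation of $w$ as a product of $u_1,\dots,u_k$ and their inverses. SCSP* (Simultaneous Conjugacy Search Problem relative to a subgroup) in $G$: an input in $I_{k,m}$ is a pair $(T,b)$ with $T=(a_1,\dots,a_k,u_1,\dots,u_m)\in F(X)^{k+m}$, $b=(v_1,\dots,v_m)\in F(X)^m$, such that the system $u_i^x=v_i$ ($i=1,\dots,m$;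 $u^x=x^{-1}ux$) has a solution $x$ in $\langle a_1,\dots,a_k\rangle\le G$; the task is to find such a solution. Genericity: the size $s$ of a tuple in $F(X)^r$ is the total or the maximal length of its components (either choice may be used, fixed throughout); $B_n=\{u\in F(X)^r: s(u)\le n\}$; $M\subseteq F(X)^r$ is exponentially generic if $1-|B_n\cap M|/|B_n|\le C\delta^n$ for some $C>0$, $\delta\in(0,1)$ and all $n$. A set of inputs is exponentially generic in $I_{k,m}$ if it contains all inputs $(T,b)$ with $T\in D$ for some exponentially generic $D\subseteq F(X)^{k+m}$. $\mathcal{FB}_{exp}$ is the class of finitely generated groups $K$ such that for every $r\ge1$ and every finite generating set $X$ of $K$ the set of tuples in $F(X)^r$ that freely generate a free subgroup of $K$ is exponentially generic. *)

(* Defs.v *)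
From HB Require Import structures.
From mathcomp Require Import all_boot all_order all_algebra finmap.
From mathcomp Require Import boolp classical_sets functions cardinality reals.

Set Implicit Arguments.
Unset Strict Implicit.
Unset Printing Implicit Defensive.

Import Order.TTheory GRing.Theory Num.Theory.

Local Open Scope classical_set_scope.

(** * Words and the free group *)

(* [(x, false)] is the generator [x], [(x, true)] is its formal inverse. *)
Notation letter X := (X * bool)%type.

Definition letterV (X : Type) (l : letter X) : letter X := (l.1, ~~ l.2).

Definition reduced (X : finType) (w : seq (letter X)) : bool :=
  sorted (fun a b => b != letterV a) w.

(* The underlying set of the free group F(X). *)
Notation freeword X := {w : seq (letter X) | reduced w}.

Definition eval_letter (K : groupType) (I : Type) (g : I -> K) (l : letter I) : K :=
  if l.2 then ((g l.1)^-1)%g else g l.1.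

Definition weval (K : groupType) (I : Type) (g : I -> K) (w : seq (letter I)) : K :=
  (\prod_(l <- w) eval_letter g l)%g.

Section Groups.
Variables (K : groupType) (X : finType) (g : X -> K).

Definition generates : Prop := forall y : K, exists w, weval g w = y.

Definition feval (w : freeword X) : K := weval g (val w).

Definition tuple_eval (r : nat) (u : r.-tuple (freeword X)) : 'I_r -> K :=
  fun i => feval (tnth u i).

Definition subgroup_gen (I : Type) (h : I -> K) : set K :=
  [set y | exists w : seq (letter I), weval h w = y].

(* The canonical map F_r -> K sending the i-th basis element to the i-th
   component of [u] is injective. *)
Definition freely_generates (r : nat) (u : r.-tuple (freeword X)) : Prop :=
  injective (fun w : freeword 'I_r => weval (tuple_eval u) (val w)).
End Groups.

(* [phi : G -> Q] is, up to isomorphism, the canonical epimorphism G -> G/N. *)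
Definition is_quotient (G Q : groupType) (N : set G)
    (phi : {multiplicative G -> Q}) : Prop :=
  (forall y : Q, exists x : G, phi x = y) /\
  (forall x : G, N x <-> phi x = 1%g).

(** * Exponential genericity *)

Inductive size_choice := TotalLength | MaxLength.

Section Genericity.
Variables (R : realType) (s : size_choice) (X : finType).

Definition tuple_size (r : nat) (u : r.-tuple (freeword X)) : nat :=
  match s with
  | TotalLength => \sum_(w <- u) size (val w)
  | MaxLength => \max_(w <- u) size (val w)
  end.

Definition ball (r n : nat) : set (r.-tuple (freeword X)) :=
  [set u | (tuple_size u <= n)%N].

(* [fset_set] is meaningful on finite sets only. *)
Lemma finite_ball (r n : nat) : finite_set (@ball r n).
Proof.
pose f (b : r.-tuple (n.-bseq (letter X))) : r.-tuple (freeword X) :=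
  map_tuple (fun w : n.-bseq (letter X) =>
    insubd (exist _ [::] isT : freeword X) (w : seq (letter X))) b.
apply: (@sub_finite_set _ _ (f @` setT)); last first.
  exact/finite_image/finite_finset.
move=> u; rewrite /ball /= => un.
have sz (w : freeword X) : w \in u -> (size (val w) <= n)%N.
  move=> wu; apply: leq_trans un; rewrite /tuple_size; case: s.
    by rewrite (big_rem w)//= leq_addr.
  by rewrite (big_rem w)//= leq_maxl.
exists (map_tuple (fun w : freeword X => insub_bseq n (val w)) u) => //.
apply: val_inj; rewrite /= -map_comp -[RHS]map_id; apply/eq_in_map => w wu /=.
apply: val_inj; rewrite val_insubd /insub_bseq /insubd insubT ?sz//= => ?.
by rewrite (valP w).
Qed.

Definition exp_generic (r : nat) (M : set (r.-tuple (freeword X))) : Prop :=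
  exists C delta : R, [/\ (0 < C)%R, (0 < delta < 1)%R &
    forall n : nat,
      (1 - #|` fset_set (@ball r n `&` M)|%:R / #|` fset_set (@ball r n)|%:R
         <= C * delta ^+ n)%R].
End Genericity.

Definition FB_exp (R : realType) (s : size_choice) (K : groupType) : Prop :=
  (exists (X : finType) (g : X -> K), generates g) /\
  forall (r : nat) (X : finType) (g : X -> K), (0 < r)%N -> generates g ->
    exp_generic R s [set u : r.-tuple (freeword X) | freely_generates g u].

(** * Multi-tape Turing machines *)

Inductive move := MoveL | MoveR | Stay.

(* [p] read-write input tapes over [A] (one per input word), and at least one
   further tape; tape [inr ord0] is the output tape.  Besides the input
   symbols [A] and the output symbols [B] the machine may use auxiliary
   symbols, and [None] is the blank. *)
Record machine (p : nat) (A B : finType) := Machine {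
  m_work : nat;
  m_aux : finType;
  m_state : finType;
  m_start : m_state;
  m_halt : pred m_state;
  m_trans : m_state -> (('I_p + 'I_m_work.+1) -> option (A + B + m_aux)) ->
    m_state * (('I_p + 'I_m_work.+1) -> option (A + B + m_aux) * move)
}.

(* Two-way infinite tape: cells left of the head, nearest first, and cells
   from the head rightwards; all cells not listed are blank. *)
Definition tape (S : Type) : Type := (seq (option S) * seq (option S))%type.

Definition tape_read (S : Type) (t : tape S) : option S := head None t.2.

Definition tape_write (S : Type) (a : option S) (t : tape S) : tape S :=
  (t.1, a :: behead t.2).

Definition tape_move (S : Type) (d : move) (t : tape S) : tape S :=
  match d with
  | MoveL => (behead t.1, head None t.1 :: t.2)
  | MoveR => (head None t.2 :: t.1, behead t.2)
  | Stay => t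
  end.

Section Runs.
Variables (p : nat) (A B : finType) (M : machine p A B).

Definition symbol : Type := (A + B + m_aux M)%type.
Definition tape_index : Type := ('I_p + 'I_(m_work M).+1)%type.
Definition config : Type := (m_state M * (tape_index -> tape symbol))%type.

Definition init (x : p.-tuple (seq A)) : config :=
  (m_start M, fun i => match i with
    | inl j => ([::], [seq Some (inl (inl a) : symbol) | a <- tnth x j])
    | inr _ => ([::], [::])
    end).

Definition step (c : config) : config :=
  if m_halt c.1 then c else
  let qa := m_trans c.1 (fun i => tape_read (c.2 i)) in
  (qa.1, fun i => tape_move (qa.2 i).2 (tape_write (qa.2 i).1 (c.2 i))).

Definition run (x : p.-tuple (seq A)) (n : nat) : config := iter n step (init x).

Definition halts_within (x : p.-tuple (seq A)) (n : nat) : Prop :=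
  m_halt (run x n).1.

(* The longest word of output symbols starting at the head. *)
Fixpoint read_output (r : seq (option symbol)) : seq B :=
  if r is Some (inl (inr b)) :: r' then b :: read_output r' else [::].

Definition outputs (x : p.-tuple (seq A)) (y : seq B) : Prop :=
  exists n, halts_within x n /\ read_output ((run x n).2 (inr ord0)).2 = y.
End Runs.

(** * Algorithms on tuples of words *)

Section Problems.
Variables (s : size_choice) (X : finType) (p : nat) (B : finType) (I : Type).
Variables (enc : I -> p.-tuple (freeword X)) (M : machine p (letter X) B).

Definition encode (x : I) : p.-tuple (seq (letter X)) :=
  [tuple of [seq val w | w <- enc x]].

(* The worst-case running time over the inputs of size at most [n] is
   O(f(n)), with an additive constant allowed. *)
Definition in_class (inputs : set I) (f : nat -> nat) : Prop :=
  exists c : nat, forall (n : nat) (x : I), inputs x ->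
    (tuple_size s (enc x) <= n)%N ->
    halts_within M (encode x) (c * (f n).+1)%N.

Definition solves_on (S : set I) (sol : I -> seq B -> Prop) : Prop :=
  forall x, S x -> exists2 y, outputs M (encode x) y & sol x y.
End Problems.

Section WordProblem.
Variables (s : size_choice) (G : groupType) (X : finType) (g : X -> G).

Definition enc1 (w : freeword X) : 1.-tuple (freeword X) := [tuple w].

Definition WP_in (f : nat -> nat) : Prop :=
  exists M : machine 1 (letter X) bool,
    in_class s enc1 M setT f /\
    solves_on enc1 M setT (fun w y => y = [:: feval g w == 1%g]).

(* Elements of the target are represented by words in the images of the
   generators. *)
Definition computable_in (Q : groupType) (phi : G -> Q) (f : nat -> nat) : Prop :=
  exists M : machine 1 (letter X) (letter X),
    in_class s enc1 M setT f /\
    solves_on enc1 M setT (fun w y => weval (phi \o g) y = phi (feval g w)).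
End WordProblem.

Section MembershipSearch.
Variables (K : groupType) (X : finType) (g : X -> K) (k : nat).

Definition MSP_instance : Type := (k.-tuple (freeword X) * freeword X)%type.

Definition MSP_enc (z : MSP_instance) : k.+1.-tuple (freeword X) :=
  [tuple of rcons z.1 z.2].

Definition MSP_inputs : set MSP_instance :=
  [set z | subgroup_gen (tuple_eval g z.1) (feval g z.2)].

Definition MSP_sol (z : MSP_instance) (y : seq (letter 'I_k)) : Prop :=
  weval (tuple_eval g z.1) y = feval g z.2.
End MembershipSearch.

Section ConjugacySearch.
Variables (G : groupType) (X : finType) (g : X -> G) (k m : nat).

(* [(T, b)] with [T = (a_1, ..., a_k, u_1, ..., u_m)] and
   [b = (v_1, ..., v_m)]. *)
Definition SCSP_instance : Type :=
  ((k + m).-tuple (freeword X) * m.-tuple (freeword X))%type.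

Definition SCSP_enc (z : SCSP_instance) : (k + m + m).-tuple (freeword X) :=
  [tuple of z.1 ++ z.2].

Definition SCSP_a (z : SCSP_instance) : 'I_k -> G :=
  fun i => feval g (tnth z.1 (lshift m i)).
Definition SCSP_u (z : SCSP_instance) : 'I_m -> G :=
  fun j => feval g (tnth z.1 (rshift k j)).
Definition SCSP_v (z : SCSP_instance) : 'I_m -> G :=
  fun j => feval g (tnth z.2 j).

Definition conjugates (z : SCSP_instance) (x : G) : Prop :=
  forall j, (SCSP_u z j ^ x)%g = SCSP_v z j.

Definition SCSP_inputs : set SCSP_instance :=
  [set z | exists2 x, subgroup_gen (SCSP_a z) x & conjugates z x].

(* The element x of <a_1, ..., a_k> is returned as a word in the a_i. *)
Definition SCSP_sol (z : SCSP_instance) (y : seq (letter 'I_k)) : Prop :=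
  conjugates z (weval (SCSP_a z) y).

Definition exp_generic_inputs (R : realType) (s : size_choice)
    (S : set SCSP_instance) : Prop :=
  S `<=` SCSP_inputs /\
  exists D : set ((k + m).-tuple (freeword X)), exp_generic R s D /\
    forall z, SCSP_inputs z -> D z.1 -> S z.
End ConjugacySearch.

(* Main.v *)
(** Only the first equation [u_1 ^ x = v_1] matters.  Since [x] lies in
    [<a_1, ..., a_k>], [v_1] lies in the subgroup generated by [T], so the
    membership algorithm of [G/N] may be run on [(T, v_1)]; it returns a word
    [y] in the letters [a_i], [u_j].  When the image of [T] is free, the free
    reduction of [y] must be the reduced word [w^-1 u_1 w], where [w] is the
    reduced word in the [a_i] with value [x]; hence the longest suffix of that
    reduction in the letters [a_i] represents [x] in [G] itself.  Reducing [y]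
    on a stack and scanning it back from the top takes time linear in the
    running time of the membership algorithm. *)

From HB Require Import structures.
From mathcomp Require Import all_boot all_order all_algebra finmap.
From mathcomp Require Import boolp classical_sets cardinality reals.
From mathcomp Require Import zify lra.
Require Import Defs.

Set Implicit Arguments.
Unset Strict Implicit.
Unset Printing Implicit Defensive.

Import Order.TTheory GRing.Theory Num.Theory.

(** * Intersections of exponentially generic sets *)

Section Genericity.
Local Open Scope ring_scope.
Local Open Scope classical_set_scope.

(** In each ball the proportions missed by [D] and by [E] add up, so the constants are added and the
    larger of the two rates serves for both. *)
Lemma exp_genericI (R : realType) (s : size_choice) (X : finType) (r : nat)
    (D E : set (r.-tuple (freeword X))) :
  exp_generic R s D -> exp_generic R s E -> exp_generic R s (D `&` E).
Proof.
move=> [c [d [c0 /andP[d0 d1] cD]]] [c' [d' [c'0 /andP[d'0 d'1] cE]]].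
exists (c + c'), (Num.max d d'); split; first exact: addr_gt0.
  by rewrite lt_max d0 gt_max d1 d'1.
move=> n; set B := ball s n.
have finB : finite_set B by exact: finite_ball.
have fin U : finite_set (B `&` U) by apply: sub_finite_set finB => x [].
(* Inclusion-exclusion, the union of the two traces lying in the ball. *)
have le_card : ((#|` fset_set (B `&` D)| + #|` fset_set (B `&` E)|) <=
    #|` fset_set B| + #|` fset_set (B `&` (D `&` E))|)%N.
  rewrite -cardfsUI -fset_setU ?fin// -fset_setI ?fin// setIIr leq_add2r.
  apply: fsubset_leq_card; rewrite -fset_set_sub.
  - by move=> x [] [].
  - by rewrite finite_setU; split; exact: fin.
  - exact: finB.
have leD := cD n; have leE := cE n; rewrite -/B in leD leE.
have pow_le (e : R) : 0 < e -> e <= Num.max d d' -> e ^+ n <= Num.max d d' ^+ n.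
  by move=> e0 e_le; apply: lerXn2r => //; rewrite nnegrE; lra.
have := pow_le d d0; rewrite le_max lexx => /(_ isT) powd.
have := pow_le d' d'0; rewrite le_max lexx orbT => /(_ isT) powd'.
have /= {}powd := ler_wpM2l (ltW c0) powd.
have /= {}powd' := ler_wpM2l (ltW c'0) powd'.
rewrite mulrDl; apply: le_trans (lerD powd powd').
apply: le_trans (lerD leD leE).
(* Over an empty ball all quotients are 0 by the convention on inverses, and the claim reads
   [1 <= 1 + 1]. *)
have [B0|Bn0] := eqVneq (#|` fset_set B|) 0%N; first by rewrite B0 invr0 !mulr0; lra.
have b0 : 0 < (#|` fset_set B|)%:R :> R by rewrite ltr0n lt0n.
rewrite -(ler_pM2r b0) [leRHS]mulrDl !mulrBl !mul1r !mulfVK ?gt_eqF//.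
by move: le_card; rewrite -(ler_nat R) !natrD; lra.
Qed.

End Genericity.

(** * Free reduction on a stack and evaluation of words *)

Section FreeReduction.
Variable I : finType.
Implicit Types (l : letter I) (w st : seq (letter I)).

Lemma letterVK : involutive (@letterV I).
Proof. by case=> i b; rewrite /letterV /= negbK. Qed.

Lemma letterV_neq l l' : (l' != letterV l) = (l != letterV l').
Proof. by rewrite eq_sym (can2_eq letterVK letterVK) eq_sym. Qed.

Lemma reduced_rev w : reduced (rev w) = reduced w.
Proof. by rewrite /reduced rev_sorted; apply: eq_sorted => a b; exact: letterV_neq. Qed.

Definition inv_word w : seq (letter I) := rev (map (@letterV I) w).

Lemma reduced_inv w : reduced (inv_word w) = reduced w.
Proof.
rewrite reduced_rev /reduced sorted_map; apply: eq_sorted => a b /=.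
by rewrite (inj_eq (inv_inj letterVK)).
Qed.

Lemma reduced_cat_cons w1 l w2 :
  reduced (w1 ++ l :: w2) = reduced (rcons w1 l) && reduced (l :: w2).
Proof.
rewrite /reduced -cat_rcons; case: w1 => //= a w1.
by rewrite cat_path last_rcons.
Qed.

(* A stack lists its word backwards, the top being the last letter. *)
Definition push_letter st l : seq (letter I) :=
  if st is l' :: st' then if l' == letterV l then st' else l :: st else [:: l].

Definition push_word st w : seq (letter I) := foldl push_letter st w.

Definition reduce w : seq (letter I) := rev (push_word [::] w).

Lemma size_push_word st w : size (push_word st w) <= size st + size w.
Proof.
elim: w st => [|l w IHw] st; first by rewrite addn0.
apply: leq_trans (IHw _) _; rewrite /= addnS -addSn leq_add2r.
by case: st => //= l' st; case: ifP => //= _; lia.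
Qed.

(** A pop leaves a tail of a reduced stack, and a push happens only onto a top that is not the
    inverse letter. *)
Lemma reduced_push_word st w : reduced st -> reduced (push_word st w).
Proof.
elim: w st => //= l w IHw st red_st; apply: IHw.
case: st red_st => //= l' st; case: ifPn => [_ /path_sorted //|].
by rewrite /reduced /= => -> ->.
Qed.

Lemma reduced_reduce w : reduced (reduce w).
Proof. by rewrite reduced_rev reduced_push_word. Qed.

Variables (K : groupType) (h : I -> K).
Local Open Scope group_scope.

Lemma weval_cons l w : weval h (l :: w) = eval_letter h l * weval h w.
Proof. by rewrite /weval big_cons. Qed.

Lemma weval_cat w1 w2 : weval h (w1 ++ w2) = weval h w1 * weval h w2.
Proof. by rewrite /weval big_cat. Qed.

Lemma weval1 l : weval h [:: l] = eval_letter h l.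
Proof. by rewrite /weval big_seq1. Qed.

Lemma eval_letterV l : eval_letter h (letterV l) = (eval_letter h l)^-1.
Proof. by case: l => i []; rewrite /eval_letter /= ?invgK. Qed.

Lemma weval_inv w : weval h (inv_word w) = (weval h w)^-1.
Proof.
elim: w => [|l w IHw]; first by rewrite /weval !big_nil invg1.
by rewrite /inv_word /= rev_cons -cats1 weval_cat weval1 -/(inv_word w) IHw
  eval_letterV weval_cons invgM.
Qed.

Lemma weval_push_word st w :
  weval h (rev (push_word st w)) = weval h (rev st) * weval h w.
Proof.
elim: w st => [|l w IHw] st /=; first by rewrite /weval big_nil mulg1.
rewrite IHw weval_cons mulgA; congr (_ * _).
case: st => [|l' st] /=; first by rewrite weval1 /weval big_nil mul1g.
case: ifPn => [/eqP ->|_]; last by rewrite rev_cons -cats1 weval_cat weval1.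
by rewrite rev_cons -cats1 weval_cat weval1 eval_letterV mulgVK.
Qed.

Lemma weval_reduce w : weval h (reduce w) = weval h w.
Proof. by rewrite weval_push_word [weval h (rev _)]big_nil mul1g. Qed.

End FreeReduction.

Lemma weval_map (I J : Type) (K : groupType) (f : I -> J) (h : J -> K)
    (w : seq (letter I)) :
  weval h [seq (f l.1, l.2) | l <- w] = weval (h \o f) w.
Proof. by rewrite /weval big_map. Qed.

Lemma gmulf_weval (I : Type) (G Q : groupType) (phi : {multiplicative G -> Q})
    (h : I -> G) (w : seq (letter I)) :
  phi (weval h w) = weval (phi \o h) w.
Proof.
have phi1 : phi 1%g = 1%g by apply: (mulgI (phi 1%g)); rewrite -gmulfM !mulg1.
have phiV x : phi (x^-1)%g = ((phi x)^-1)%g.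
  by apply: (mulgI (phi x)); rewrite -gmulfM !mulgV.
rewrite /weval (big_morph phi (@gmulfM _ _ phi) phi1); apply: eq_bigr => -[i b] _.
by rewrite /eval_letter; case: b => //=.
Qed.

(** * Reducedness of formal conjugates *)

Section ReducedConjugate.
Variable I : finType.

Lemma reduced_cons (i : I) (b : bool) (w : seq (letter I)) :
  i \notin [seq l.1 | l <- w] -> reduced ((i, b) :: w) = reduced w.
Proof.
case: w => [//|l w]; rewrite inE negb_or => /andP[i_l _].
rewrite /reduced /=; apply: andb_idl => _.
by apply: contraNneq i_l => ->.
Qed.

(** The letter [i] occurs in [w] with neither sign, so nothing cancels on either side of it; the
    left half is handled by reversal. *)
Lemma reduced_conj (i : I) (b : bool) (w : seq (letter I)) :
  i \notin [seq l.1 | l <- w] -> reduced w ->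
  reduced (inv_word w ++ (i, b) :: w).
Proof.
move=> i_w red_w; rewrite reduced_cat_cons reduced_cons// red_w andbT.
rewrite -reduced_rev rev_rcons revK reduced_cons.
  by rewrite -reduced_rev -/(inv_word w) reduced_inv.
by rewrite -map_comp.
Qed.

End ReducedConjugate.

(** * The longest suffix in the first [k] letters *)

Section LeftSuffix.
Variables k m : nat.

(** [st] is a stack, hence a word read from its end; consing onto [acc] restores the order of the
    suffix. *)
Fixpoint left_suffix (st : seq (letter 'I_(k + m))) (acc : seq (letter 'I_k)) :=
  if st is l :: st' then
    if split l.1 is inl i then left_suffix st' ((i, l.2) :: acc) else acc
  else acc.

Lemma left_suffix_rev (w : seq (letter 'I_k)) st acc :
  left_suffix (rev [seq (lshift m l.1, l.2) | l <- w] ++ st) acc =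
  left_suffix st (w ++ acc).
Proof.
elim/last_ind: w acc => [//|w [i b] IHw] acc.
by rewrite map_rcons rev_rcons /= (unsplitK (inl i)) IHw cat_rcons.
Qed.

End LeftSuffix.

(** * Control states of the extracting machine *)

Inductive phase (S L : Type) : Type :=
  Simulating of S | Reading | Pending of L | Scanning | Done.
Arguments Reading {S L}.
Arguments Scanning {S L}.
Arguments Done {S L}.

Section PhaseFinite.
Variables S L : finType.

Definition phase_code (q : phase S L) : S + L + 'I_3 :=
  match q with
  | Simulating s => inl (inl s)
  | Pending l => inl (inr l)
  | Reading => inr (@Ordinal 3 0 isT)
  | Scanning => inr (@Ordinal 3 1 isT)
  | Done => inr (@Ordinal 3 2 isT)
  end.

Definition phase_decode (c : S + L + 'I_3) : phase S L :=
  match c with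
  | inl (inl s) => Simulating _ s
  | inl (inr l) => Pending _ l
  | inr i => if i == 0 :> nat then Reading else if i == 1 :> nat then Scanning else Done
  end.

Lemma phase_codeK : cancel phase_code phase_decode.
Proof. by case. Qed.

HB.instance Definition _ := Finite.copy (phase S L) (can_type phase_codeK).
End PhaseFinite.

(** * Output length against running time *)

Section Runs.
Variables (p : nat) (A B : finType) (M : machine p A B) (x : p.-tuple (seq A)).

Lemma iter_step_halted n (c : config M) : m_halt c.1 -> iter n (@step _ _ _ M) c = c.
Proof. by move=> hc; elim: n => //= n ->; rewrite /step hc. Qed.

Lemma run_halted n n' : halts_within M x n -> n <= n' -> run M x n' = run M x n.
Proof. by move=> hn /subnK <-; rewrite /run iterD iter_step_halted. Qed.

Lemma size_read_output (r : seq (option (symbol M))) : size (read_output r) <= size r.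
Proof. by elim: r => //= -[[[a|b]|c]|]. Qed.

(** Only a left move lengthens the right half, by one cell; the successor in the bound absorbs the
    cell created by writing on an empty half. *)
Lemma size_step (c : config M) i n :
  size (c.2 i).2 <= n.+1 -> size ((step c).2 i).2 <= n.+2.
Proof.
rewrite /step; case: ifP => _ /= sz_i; first exact: leqW.
have sz_tl : size (behead (c.2 i).2) <= n by rewrite size_behead; lia.
by case: ((m_trans _ _).2 i) => a [] /=; do 3?[exact: sz_tl | apply: leqW].
Qed.

Lemma size_output_run n : size (read_output ((run M x n).2 (inr ord0)).2) <= n.+1.
Proof.
apply: leq_trans (size_read_output _) _.
by elim: n => [//|n IHn]; rewrite [run _ _ _]iterS size_step.
Qed.

End Runs.

(** * The machine that simulates [A], reduces its output and extracts the suffix *)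

Section Extract.
Variables (p q : nat) (le_pq : p <= q) (A0 : finType) (k m : nat).
Notation J := 'I_(k + m).
Variable (A : machine p A0 (letter J)).

(** A copy of the whole alphabet of [A], in which the simulation writes; the output alphabet stays
    free for the stack. *)
Definition extract_aux : finType := (A0 + letter J + m_aux A)%type.
Notation sym := (A0 + letter 'I_k + extract_aux)%type.

Definition decode (o : option sym) : option (symbol A) :=
  match o with
  | Some (inl (inl a)) => Some (inl (inl a))
  | Some (inr c) => Some c
  | _ => None
  end.

(** Letters of the first [k] generators are stacked as output symbols and all others as auxiliary
    ones. The stack tape thus doubles as the output tape: a head placed on the first letter of the
    suffix already outputs it. *)
Definition stack_symbol (l : letter J) : sym :=
  if split l.1 is inl i then inl (inr (i, l.2)) else inr (inl (inr l)).

Lemma stack_symbol_inj : injective stack_symbol.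
Proof.
move=> [j b] [j' b']; rewrite /stack_symbol /=.
case: splitP => i eq_i; case: splitP => i' eq_i' // -[];
  do ?[move=> ->] => //; move=> eqi ->; congr pair; apply: ord_inj.
by rewrite eq_i eq_i' eqi.
Qed.

Notation ix := ('I_q + 'I_(m_work A).+2)%type.

(** Tape [inr ord0] is reserved for the stack, so the output tape of [A] becomes
    [inr (lift ord0 ord0)]. *)
Definition embed_tape (i : tape_index A) : ix :=
  match i with
  | inl j => inl (widen_ord le_pq j)
  | inr j => inr (lift ord0 j)
  end.

Definition simulated_tape (i : ix) : option (tape_index A) :=
  match i with
  | inl j => omap inl (insub (val j))
  | inr j => omap inr (unlift ord0 j)
  end.

Lemma embed_tapeK : pcancel embed_tape simulated_tape.
Proof.
case=> j /=; last by rewrite liftK.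
by rewrite insubT //= => lt_j; congr (Some (inl _)); apply: val_inj.
Qed.

(* The input tapes beyond the first [p], never read, copy the actions of the
   output tape. *)
Definition act (f : tape_index A -> option sym * move) (o : option sym * move) :
    ix -> option sym * move :=
  fun i => if simulated_tape i is Some j then f j else o.

Notation st := (phase (m_state A) (letter J)).

(** A pop is a single step, erasing and moving left. A step writes before it moves, so a push takes
    two, and [Pending l] carries the letter to the fresh cell. *)
Definition extract_trans (s : st) (a : ix -> option sym) :
    st * (ix -> option sym * move) :=
  let top := a (inr ord0) in
  let shift d := fun j => (a (embed_tape j), d) in
  match s with
  | Simulating s =>
      if m_halt s then (Reading, act (shift Stay) (top, Stay)) else
      let sa := m_trans s (fun j => decode (a (embed_tape j))) in
      (Simulating _ sa.1,
       act (fun j => (omap inr (sa.2 j).1, (sa.2 j).2)) (top, Stay))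
  | Reading =>
      if decode (a (embed_tape (inr ord0))) is Some (inl (inr l)) then
        if top == Some (stack_symbol (letterV l))
        then (Reading, act (shift MoveR) (None, MoveL))
        else (Pending _ l, act (shift Stay) (top, MoveR))
      else (Scanning, act (shift Stay) (top, Stay))
  | Pending l => (Reading, act (shift MoveR) (Some (stack_symbol l), Stay))
  | Scanning =>
      if top is Some (inl (inr _)) then (Scanning, act (shift Stay) (top, MoveL))
      else (Done, act (shift Stay) (top, MoveR))
  | Done => (Done, act (shift Stay) (top, Stay))
  end.

Definition extract : machine q A0 (letter 'I_k) :=
  @Machine q A0 (letter 'I_k) (m_work A).+1 extract_aux
    (phase (m_state A) (letter J)) (Simulating _ (m_start A))
    (fun s => if s is Done then true else false) extract_trans.

Definition map_tape (S S' : Type) (f : option S -> option S') (t : tape S) : tape S' :=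
  (map f t.1, map f t.2).

Notation cfg := (config extract).
Notation out_tape c := (c.2 (inr ord0)).
Notation stepC := (@step _ _ _ extract).

(** The stack tape is required to be blank rather than empty, because idling writes a blank into the
    head cell. *)
Definition simulates (c : cfg) (cA : config A) : Prop :=
  [/\ c.1 = Simulating _ cA.1,
      forall j, map_tape decode (c.2 (embed_tape j)) = cA.2 j,
      (out_tape c).1 = [::] & all (eq_op None) (out_tape c).2].
Lemma act_embed f o j : act f o (embed_tape j) = f j.
Proof. by rewrite /act embed_tapeK. Qed.

Lemma act_out f o : act f o (inr (lift ord0 ord0)) = f (inr ord0).
Proof. exact: (act_embed f o (inr ord0)). Qed.

Lemma act_stack f o : act f o (inr ord0) = o.
Proof. by rewrite /act /= unlift_none. Qed.

Lemma map_tape_step (d : move) (a : option sym) (t : tape sym) :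
  map_tape decode (tape_move d (tape_write a t)) =
  tape_move d (tape_write (decode a) (map_tape decode t)).
Proof. by case: t => -[|b l] [|c r]; case: d. Qed.

Lemma tape_read_decode (t : tape sym) :
  tape_read (map_tape decode t) = decode (tape_read t).
Proof. by case: t => l []. Qed.

Lemma blank_tape (S : eqType) (t : tape S) :
  all (eq_op None) t.2 -> tape_read t = None /\ all (eq_op None) (behead t.2).
Proof. by case: t => l [|a r] //= /andP[/eqP <-]. Qed.

Lemma simulates_step (c : cfg) (cA : config A) :
  simulates c cA -> ~~ m_halt cA.1 -> simulates (stepC c) (@step _ _ _ A cA).
Proof.
case: c cA => [s ts] [sA tsA] [/= -> tapes out1 out2] live.
rewrite /step /= (negPf live) /=.
have reads : (fun j => decode (tape_read (ts (embed_tape j)))) =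
             (fun j => tape_read (tsA j)).
  by apply: funext => j; rewrite -tapes tape_read_decode.
rewrite reads; split=> //=.
- move=> j; rewrite act_embed map_tape_step tapes /=.
  congr (tape_move _ (tape_write _ _)).
  by case: ((m_trans _ _).2 j).1.
- by rewrite act_stack.
- by rewrite act_stack /=; have [-> ->] := blank_tape out2.
Qed.

(** The head is on the top letter; the final [None] is the blank starting cell, which marks the
    bottom of the stack. *)
Definition stacked (stk : seq (letter J)) (t : tape sym) : Prop :=
  tape_read t :: t.1 = rcons [seq Some (stack_symbol l) | l <- stk] None /\
  all (eq_op None) (behead t.2).

Definition reading (y stk : seq (letter J)) (c : cfg) : Prop :=
  [/\ c.1 = Reading,
      read_output (map_tape decode (c.2 (embed_tape (inr ord0)))).2 = y &
      stacked stk (out_tape c)].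

Lemma read_output_idle (t : tape sym) :
  read_output (map_tape decode (tape_move Stay (tape_write (tape_read t) t))).2 =
  read_output (map_tape decode t).2.
Proof. by case: t => l []. Qed.

Lemma stacked_idle stk (t : tape sym) :
  stacked stk t -> stacked stk (tape_move Stay (tape_write (tape_read t) t)).
Proof. by case: t => l []. Qed.

Lemma stacked_push stk l (t : tape sym) : stacked stk t ->
  stacked (l :: stk)
    (tape_move Stay (tape_write (Some (stack_symbol l))
      (tape_move MoveR (tape_write (tape_read t) t)))).
Proof.
case: t => lft rgt [/= eq_st blank]; split=> /=.
  by rewrite /tape_read /= -eq_st.
by case: (behead rgt) blank => //= a r /andP[].
Qed.

Lemma stacked_pop stk l (t : tape sym) : stacked (l :: stk) t ->
  stacked stk (tape_move MoveL (tape_write None t)).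
Proof.
case: t => lft rgt [/= [_ ->] blank]; split=> //=.
by rewrite /tape_read /=; case: stk.
Qed.

Lemma simulates_halted (c : cfg) (cA : config A) :
  simulates c cA -> m_halt cA.1 ->
  reading (read_output (cA.2 (inr ord0)).2) [::] (stepC c).
Proof.
case: c cA => [s ts] [sA tsA] [/= -> tapes out1 out2] halted.
rewrite /step /= halted; split=> //=.
  by rewrite act_out read_output_idle tapes.
rewrite act_stack; apply: stacked_idle.
by have [top blank] := blank_tape out2; split; rewrite // top out1.
Qed.

Lemma decode_read_output l y (t : tape sym) :
  read_output (map_tape decode t).2 = l :: y ->
  decode (tape_read t) = Some (inl (inr l)) /\
  forall a, read_output (map_tape decode (tape_move MoveR (tape_write a t))).2 = y.
Proof.
case: t => lft [//|b r] /=; rewrite /tape_read /=.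
by case: (decode b) => // -[[|l']|] //= [-> ->].
Qed.

Lemma stacked_top stk (t : tape sym) : stacked stk t ->
  tape_read t = ohead [seq stack_symbol l | l <- stk].
Proof. by case: stk => [|l stk] [/= []]. Qed.

Lemma reading_cons l y stk (c : cfg) : reading (l :: y) stk c ->
  exists2 t, t <= 2 & reading y (push_letter stk l) (iter t stepC c).
Proof.
case: c => s ts [/= -> /decode_read_output[out_l out_y] stk_c].
have top := stacked_top stk_c.
have [top_l|top_l] :=
    eqVneq (tape_read (ts (inr ord0))) (Some (stack_symbol (letterV l))).
  exists 1 => //=; rewrite /step /= out_l top_l eqxx.
  split=> //=; first by rewrite act_out out_y.
  rewrite act_stack; case: stk stk_c top => [|l' stk] stk_c; rewrite top_l // => -[].
  by move/stack_symbol_inj => <- /=; rewrite eqxx; exact: stacked_pop stk_c.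
exists 2 => //; rewrite [iter _ _ _]/= {2}/step /= out_l (negPf top_l) /step /=.
split=> //=; first by rewrite !act_out /= (out_y None).
rewrite !act_stack; have -> : push_letter stk l = l :: stk.
  case: stk {stk_c} top => //= l' stk top; case: eqP top => // ->.
  by move=> top; rewrite top eqxx in top_l.
exact: stacked_push.
Qed.

Lemma reading_word y stk (c : cfg) : reading y stk c ->
  exists2 t, t <= 2 * size y & reading [::] (push_word stk y) (iter t stepC c).
Proof.
elim: y stk c => [|l y IHy] stk c c_y; first by exists 0.
have [t le_t /IHy[t' le_t' c_t']] := reading_cons c_y.
by exists (t' + t); [rewrite /=; lia|rewrite iterD].
Qed.

(** [stk] is the part not yet passed on the way down, and [acc] is the output word just right of the
    head. *)
Definition scanning (stk : seq (letter J)) (acc : seq (letter 'I_k)) (c : cfg) : Prop :=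
  [/\ c.1 = Scanning,
      tape_read (out_tape c) :: (out_tape c).1 =
        rcons [seq Some (stack_symbol l) | l <- stk] None &
      read_output (behead (out_tape c).2) = acc].

Lemma reading_nil stk (c : cfg) : reading [::] stk c -> scanning stk [::] (stepC c).
Proof.
case: c => s ts [/= -> out_nil [eq_st blank]].
have no_letter l : decode (tape_read (ts (inr (lift ord0 ord0)))) <> Some (inl (inr l)).
  case: (ts _) out_nil => lft [//|b r] /=; rewrite /tape_read /=.
  by case: (decode b) => // -[[]|].
rewrite /step /=; case: (decode _) no_letter => [[[a|l]|b]|] no_letter.
2: by case: (no_letter l).
all: split=> //=; rewrite act_stack //=.
all: by case: (behead _) blank => //= a' r /andP[/eqP <-].
Qed.

(** Each left move passes one output symbol; at an auxiliary symbol or the bottom blank, one move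
    right puts the head at the start of the suffix. *)
Lemma scanning_halts stk acc (c : cfg) : scanning stk acc c ->
  exists t, [/\ t <= (size stk).+1, m_halt (iter t stepC c).1 &
    read_output (out_tape (iter t stepC c)).2 = left_suffix stk acc].
Proof.
elim: stk acc c => [|l stk IHstk] acc [s ts] [/= -> [top lft] out_acc].
  exists 1; rewrite /= /step /= top; split=> //=.
  by rewrite act_stack.
case eq_l: (split l.1) => [i|j]; last first.
  exists 1; rewrite /= /step /= top /stack_symbol eq_l; split=> //=.
  by rewrite act_stack.
have [|t [le_t halt_t out_t]] :=
    IHstk ((i, l.2) :: acc) (stepC (@Scanning _ _ : m_state extract, ts)).
  rewrite /step /= top /stack_symbol eq_l; split=> //=; rewrite act_stack /=.
    by rewrite lft /tape_read /=; case: (stk).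
  by rewrite out_acc.
by exists t.+1; rewrite iterSr.
Qed.

Section ExtractRun.
Variables (x : p.-tuple (seq A0)) (x' : q.-tuple (seq A0)).
Hypothesis x_prefix : forall j, tnth x' (widen_ord le_pq j) = tnth x j.

Lemma simulates_run n : (forall i, i < n -> ~~ m_halt (run A x i).1) ->
  simulates (run extract x' n) (run A x n).
Proof.
elim: n => [_|n IHn live].
  split=> // -[] j //=; rewrite x_prefix /map_tape /=; congr pair.
  by rewrite -map_comp.
rewrite /run !iterS; apply: simulates_step; last exact: live.
by apply: IHn => i lt_i; apply: live; exact: ltnW.
Qed.

Lemma extract_run n : halts_within A x n ->
  exists t, [/\ t <= 4 * n + 6, halts_within extract x' t &
    read_output ((run extract x' t).2 (inr ord0)).2 =
    left_suffix (push_word [::] (read_output ((run A x n).2 (inr ord0)).2)) [::]].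
Proof.
(* The simulation is step by step only while [A] is live, so it is followed up to the first halting
   time [n0]. *)
move=> halt_n; have := ex_minnP (ex_intro (fun i => m_halt (run A x i).1) n halt_n).
case=> n0 halt_n0 min_n0; have le_n0 := min_n0 _ halt_n.
rewrite (run_halted halt_n0 le_n0).
set y := read_output _; have sz_y : size y <= n0.+1 := size_output_run A x n0.
have /simulates_halted/(_ halt_n0) : simulates (run extract x' n0) (run A x n0).
  by apply: simulates_run => i; apply: contraTN => /min_n0; rewrite -leqNgt.
rewrite -/y => /reading_word[t1 le_t1].
move=> /reading_nil/scanning_halts[t2 [le_t2 halt_t2 out_t2]].
have {}le_t2 : t2 <= n0.+2.
  apply: leq_trans le_t2 _; rewrite ltnS.
  exact: leq_trans (size_push_word [::] _) sz_y.
have {}le_t1 : t1 <= 2 * n0.+1 by apply: leq_trans le_t1 _; rewrite leq_mul2l sz_y.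
(* Simulation takes [n0] steps, reading at most [2 * n0.+1], scanning at most [n0.+2], and the two
   phase changes one each: [4 * n0 + 6] in all. *)
exists (t2 + (t1 + n0.+1).+1); split; first by lia.
  by rewrite /halts_within /run iterD iterS iterD iterS.
by rewrite /run iterD iterS iterD iterS.
Qed.

End ExtractRun.
End Extract.

(** * From membership solutions to conjugators *)

Section ConjugatingWord.
Variables (k m : nat).

Definition left_word (w : seq (letter 'I_k)) : seq (letter 'I_(k + m)) :=
  [seq (lshift m l.1, l.2) | l <- w].

Definition conj_word (j : 'I_m) (w : seq (letter 'I_k)) : seq (letter 'I_(k + m)) :=
  inv_word (left_word w) ++ (rshift k j, false) :: left_word w.

Lemma reduced_conj_word (j : 'I_m) w : reduced w -> reduced (conj_word j w).
Proof.
move=> red_w; apply: reduced_conj.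
  by apply/mapP => -[_ /mapP[l _ ->]] /= /eqP; rewrite eq_rlshift.
rewrite /reduced sorted_map; apply: sub_sorted red_w => -[a ea] [b eb] /=.
by apply: contraNneq => -[/ord_inj -> ->].
Qed.

Lemma left_suffix_conj_word (j : 'I_m) w : left_suffix (rev (conj_word j w)) [::] = w.
Proof.
rewrite /conj_word rev_cat rev_cons cat_rcons left_suffix_rev cats0 /=.
by rewrite (unsplitK (inr j)).
Qed.

Variables (G : groupType) (X : finType) (g : X -> G).

Lemma weval_conj_word (z : SCSP_instance X k m) (j : 'I_m) w :
  weval (tuple_eval g z.1) (conj_word j w) =
  (SCSP_u g z j ^ weval (SCSP_a g z) w)%g.
Proof. by rewrite weval_cat weval_inv weval_cons weval_map. Qed.

Lemma tuple_eval_quotient (Q : groupType) (phi : {multiplicative G -> Q})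
    (r : nat) (u : r.-tuple (freeword X)) :
  tuple_eval (phi \o g) u = phi \o tuple_eval g u.
Proof. by apply: funext => i; rewrite /= /tuple_eval /feval gmulf_weval. Qed.

Definition membership_instance (hm : 0 < m) (z : SCSP_instance X k m) :
    MSP_instance X (k + m) :=
  (z.1, tnth z.2 (Ordinal hm)).

(** The input lists [T], then [v_1], then the other [v_j], so [A] can be simulated on the given
    tapes without copying. *)
Lemma MSP_enc_prefix (hm : 0 < m) (le_km : (k + m).+1 <= k + m + m) z j :
  tnth (encode (@SCSP_enc X k m) z) (widen_ord le_km j) =
  tnth (encode (@MSP_enc X (k + m)) (membership_instance hm z)) j.
Proof.
rewrite !tnth_map; congr val; case: z => T b.
rewrite /membership_instance /=; set v := tnth b _.
rewrite !(tnth_nth v) /= nth_rcons nth_cat size_tuple.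
case: ltnP => // le_j; have -> : j = k + m :> nat by have := ltn_ord j; lia.
by rewrite eqxx subnn; apply/esym/tnth_nth.
Qed.

Lemma MSP_enc_size (s : size_choice) (hm : 0 < m) (z : SCSP_instance X k m) :
  tuple_size s (MSP_enc (membership_instance hm z)) <= tuple_size s (SCSP_enc z).
Proof.
case: z => T b; rewrite /tuple_size /= -cats1.
have [w ->] : exists w, b = tnth b (Ordinal hm) :: w :> seq _.
  case: m hm b => // m' hm' b; exists (behead b).
  by rewrite (tnth_nth (thead b)) /=; case: b => -[].
by case: s; rewrite !big_cat !big_cons big_nil /=; lia.
Qed.

Lemma MSP_inputs_of_SCSP (Q : groupType) (phi : {multiplicative G -> Q})
    (hm : 0 < m) (z : SCSP_instance X k m) :
  SCSP_inputs g z -> MSP_inputs (phi \o g) (membership_instance hm z).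
Proof.
move=> [_ [w <-] conj_z]; exists (conj_word (Ordinal hm) w).
by rewrite tuple_eval_quotient -gmulf_weval weval_conj_word conj_z /feval gmulf_weval.
Qed.

Lemma SCSP_sol_left_suffix (Q : groupType) (phi : {multiplicative G -> Q})
    (hm : 0 < m) (z : SCSP_instance X k m) (y : seq (letter 'I_(k + m))) :
  freely_generates (phi \o g) z.1 -> SCSP_inputs g z ->
  MSP_sol (phi \o g) (membership_instance hm z) y ->
  SCSP_sol g z (left_suffix (push_word [::] y) [::]).
Proof.
move=> free_z [x [w w_x] conj_z] sol_y; set j := Ordinal hm.
have red_w := reduced_conj_word j (reduced_reduce w).
pose r1 : freeword 'I_(k + m) := exist _ (reduce y) (reduced_reduce y).
pose r2 : freeword 'I_(k + m) := exist _ (conj_word j (reduce w)) red_w.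
(* Both reduced words evaluate to the image of [v_1] in [Q], so freeness makes them equal letter by
   letter. *)
have /(congr1 val) : r1 = r2.
  apply: free_z; rewrite /= weval_reduce sol_y tuple_eval_quotient.
  by rewrite -gmulf_weval weval_conj_word weval_reduce w_x conj_z /feval gmulf_weval.
move=> /= /(canRL revK) ->; rewrite left_suffix_conj_word => i.
(* The extracted word is [reduce w], with value [x] in [G] itself, so all [m] equations hold. *)
by rewrite /SCSP_sol weval_reduce w_x conj_z.
Qed.

End ConjugatingWord.

Theorem corollary6p10 (R : realType) (s : size_choice)
    (G Q : groupType) (X : finType) (g : X -> G)
    (N : set G) (phi : {multiplicative G -> Q}) (C1 C2 C3 : nat -> nat)
    (hgen : generates g)
    (hWP : WP_in s g C1)
    (hquot : is_quotient N phi)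
    (hFB : FB_exp R s Q)
    (hphi : computable_in s g phi C2)
    (hMSP : forall k : nat,
      exists (A : machine k.+1 (letter X) (letter 'I_k))
             (M : set (k.-tuple (freeword X))),
        [/\ exp_generic R s M,
            in_class s (@MSP_enc X k) A (@MSP_inputs Q X (phi \o g) k) C3 &
            solves_on (@MSP_enc X k) A
              [set z | MSP_inputs (phi \o g) z /\ M z.1]
              (@MSP_sol Q X (phi \o g) k)])
    (k m : nat) (hk : (0 < k)%N) (hm : (0 < m)%N) :
  exists C : machine (k + m + m) (letter X) (letter 'I_k),
    in_class s (@SCSP_enc X k m) C (@SCSP_inputs G X g k m)
      (fun n => n ^ 2 + C1 n + C2 n + C3 n)%N /\
    exists S : set (SCSP_instance X k m),
      exp_generic_inputs g R s S /\
      solves_on (@SCSP_enc X k m) C S (@SCSP_sol G X g k m).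
Proof.
have genQ : generates (phi \o g).
  move=> y; have [x <-] := hquot.1 y; have [w <-] := hgen x.
  by exists w; rewrite gmulf_weval.
have [_ /(_ (k + m) X (phi \o g))] := hFB.
rewrite addn_gt0 hk => /(_ isT genQ) free_generic.
have [A [M [M_generic A_class A_solves]]] := hMSP (k + m).
have le_km : ((k + m).+1 <= k + m + m)%N by rewrite -[leqLHS]addn1 leq_add2l.
have run z n := extract_run (MSP_enc_prefix hm le_km z) (n := n) (A := A).
exists (extract le_km A); split.
  (* The constant absorbs [4 * (c * (C3 n).+1) + 6]. Every SCSP* input yields a membership input, so
     this bound holds on all inputs, generic or not. *)
  have [c A_halts] := A_class; exists (4 * c + 6)%N => n z z_in z_n.
  have := A_halts n _ (MSP_inputs_of_SCSP phi hm z_in)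
    (leq_trans (MSP_enc_size s hm z) z_n).
  move=> /run[t [le_t halt_t _]]; rewrite /halts_within (run_halted halt_t) //.
  by apply: leq_trans le_t _; nia.
(* Both conditions concern [T] alone, as genericity of a set of inputs demands. *)
exists [set z | SCSP_inputs g z /\
  (freely_generates (phi \o g) z.1 /\ M z.1)]%classic.
split.
  split=> [z [] //|]; exists ([set u | freely_generates (phi \o g) u] `&` M)%classic.
  by split; [exact: exp_genericI|move=> z z_in [free_z M_z]].
move=> z [z_in [free_z M_z]].
have [|y [n [halt_n out_n]] sol_y] := A_solves (membership_instance hm z).
  by split=> //; exact: MSP_inputs_of_SCSP.
have [t [_ halt_t out_t]] := run z n halt_n.
exists (left_suffix (push_word [::] y) [::]); first by exists t; rewrite out_t out_n.
exact: SCSP_sol_left_suffix sol_y.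
Qed.
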